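(* Let $\theta$ be a real number whose simple continued fraction has the form $$\theta=[c_0;c_1,\ldots,c_{n_1},a_0,c_{n_1+1},\ldots,c_{n_1+n_2},a_1,c_{n_1+n_2+1},\ldots],$$ where $\lim_{i\to\infty}a_i=\infty$, every $n_j\ge 0$, and $\{c_i\}$ is a bounded sequence. Let $\phi=(r\theta+m)/n$, where $r,m,n$ are integers with $n\ge 2$, $\gcd(r,m,n)=1$ and $0\le r,m<n$. Then $L(\theta,\phi)=0$ if and only if there exist infinitely many leapers $\mathcal{L}_j$ of $\theta$ such that $g_j\,\mathcal{L}_j\equiv (m,-r)\pmod n$ for some integer $g_j$ that is invertible modulo $n$.
   Context: For real numbers $\theta,\phi$ with $\phi\notin\mathbb{Z}\theta+\mathbb{Z}$, the inhomogeneous approximation constant is $L(\theta,\phi)=\liminf_{|q|\to\infty}\{|q|\,\|q\theta-\phi\| : q\in\mathbb{Z}\}$, where $\|x\|$ is the distance from $x$ to the nearest integer. Write $\theta=[b_0;b_1,b_2,\ldots]$ for the simple continued fraction. For $i\ge0$ the $i$-th convergent is the pair $\mathcal{P}_i=(p_i,q_i)$ with $q_i>0$, $\gcd(p_i,q_i)=1$ and $p_i/q_i=[b_0;b_1,\ldots,b_i]$. In the given continued fraction the partial quotients are split into the terms $c_i$ and the terms $a_j$. A subscript $I_j\ge 0$ is called a leaping subscript if $b_{I_j+1}$ is the term $a_j$; the associated leaper is $\mathcal{L}_j=\mathcal{P}_{I_j}=(p_{I_j},q_{I_j})$. Congruences between integer pairs are componentwise. *)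

(* Defs.v *)
From HB Require Import structures.
From mathcomp Require Import all_boot all_order all_algebra.
From mathcomp Require Import all_classical all_reals all_analysis.

Set Implicit Arguments.
Unset Strict Implicit.
Unset Printing Implicit Defensive.

Import Order.TTheory GRing.Theory Num.Theory.
Import numFieldNormedType.Exports.

Local Open Scope classical_set_scope.
Local Open Scope ring_scope.

(* [b 0; b 1, ..., b i] *)
Fixpoint finite_cf (b : nat -> int) (i : nat) : rat :=
  if i is i'.+1 then (b 0%N)%:~R + (finite_cf (fun k => b k.+1) i')^-1
  else (b 0%N)%:~R.

Definition simple_cf (R : realType) (theta : R) (b : nat -> int) : Prop :=
  (forall i, 0 < b i.+1) /\
  (fun i => ratr (finite_cf b i) : R) @ \oo --> theta.

(* numq and denq are the coprime numerator and positive denominator. *)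
Definition convergent (b : nat -> int) (i : nat) : int * int :=
  (numq (finite_cf b i), denq (finite_cf b i)).

(* The lengths l are indexed from 1, as in l 1, l 2, ...; l 0 is not used.
   The term a_j follows c_0, the j+1 blocks of lengths l 1, ..., l (j+1) and
   the j terms a_0, ..., a_(j-1), so it is b (leap l j).+1. *)
Definition leap (l : nat -> nat) (j : nat) : nat :=
  (\sum_(1 <= k < j.+2) l k + j)%N.

(* b = c_0, c_1, ..., c_(l 1), a_0, c_(l 1 + 1), ..., c_(l 1 + l 2), a_1, ...
   When almost all the l k vanish, only finitely many terms of c occur in b
   and the other ones are arbitrary. *)
Definition interleaving (b c a : nat -> int) (l : nat -> nat) : Prop :=
  [/\ b 0%N = c 0%N,
      (forall j k, (1 <= k <= l j.+1)%N ->
         b (\sum_(1 <= i < j.+1) l i + j + k)%N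
         = c (\sum_(1 <= i < j.+1) l i + k)%N)
    & (forall j, b (leap l j).+1 = a j)].

Definition leaper (b : nat -> int) (l : nat -> nat) (j : nat) : int * int :=
  convergent b (leap l j).

Definition dist_int (R : realType) (x : R) : R :=
  inf [set `|x - z%:~R| | z in [set: int]].

(* The filter of neighbourhoods of |q| = +oo on int. *)
Definition abs_infty : set_system int :=
  filter_from [set: nat] (fun N => [set q : int | (N <= `|q|)%N]).

(* limf_einf requires a filteredType; discrete_topology int provides the
   structure (which does not affect the value) on the carrier int. *)
Definition inhom_const (R : realType) (theta phi : R) : \bar R :=
  let f (q : int) : \bar R :=
    (`|q%:~R| * dist_int (q%:~R * theta - phi))%:E in
  limf_einf (f : discrete_topology int -> \bar R) abs_infty.

Definition invertible_mod (n g : int) : Prop :=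
  exists h : int, (g * h = 1 %[mod n])%Z.

Definition eqmod_pair (n : int) (P Q : int * int) : Prop :=
  (P.1 = Q.1 %[mod n])%Z /\ (P.2 = Q.2 %[mod n])%Z.

(* Main.v *)
Require Import Defs.
From HB Require Import structures.
From mathcomp Require Import all_boot all_order all_algebra.
From mathcomp Require Import all_classical all_reals all_analysis.
From mathcomp Require Import ring lra zify.

(* Put Q = n q - r and P = n z + m, so that (P, Q) is congruent to (m, -r)
   modulo n and n (q theta - phi - z) = Q theta - P; hence L(theta, phi) is the
   lower limit of |Q| |Q theta - P| / n^2 over these pairs.  If
   |Q| |Q theta - P| < 1/2 then (P, Q) = d (p_i, q_i) for some convergent
   (Legendre), and gcd(r, m, n) = 1 forces d to be invertible modulo n.  Since
   q_i |q_i theta - p_i| is between 1 / (b_(i+1) + 2) and 1 / b_(i+1), arbitrarily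
   small values occur exactly along the leapers.  Conversely a leaper with
   multiplier g gives the pair g (p_i, q_i), where g may be taken in ]0, n[. *)

Set Implicit Arguments.
Unset Strict Implicit.
Unset Printing Implicit Defensive.

Import Order.TTheory GRing.Theory Num.Theory.
Import numFieldNormedType.Exports.

Local Open Scope classical_set_scope.
Local Open Scope ring_scope.

(** * Convergents *)

(* The pair (p_i, q_i), by the same recursion on the left as [finite_cf]. *)
Fixpoint continuant (b : nat -> int) (i : nat) : int * int :=
  if i is i'.+1 then
    let v := continuant (fun k => b k.+1) i' in (b 0%N * v.1 + v.2, v.1)
  else (b 0%N, 1).

(** The classical recurrence at the right end of the expansion; as the definition recurses on the
    left, the induction hypothesis is applied to the shifted sequence. *)
Lemma continuantSS b i : continuant b i.+2 =
  (b i.+2 * (continuant b i.+1).1 + (continuant b i).1,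
   b i.+2 * (continuant b i.+1).2 + (continuant b i).2).
Proof.
elim: i b => [|i IH] b; first by rewrite /=; congr pair; ring.
have -> : continuant b i.+3 = (b 0%N * (continuant (fun k => b k.+1) i.+2).1
   + (continuant (fun k => b k.+1) i.+2).2, (continuant (fun k => b k.+1) i.+2).1) by [].
by rewrite IH /=; congr pair; ring.
Qed.

Lemma continuant_numSS b i : (continuant b i.+2).1 =
  b i.+2 * (continuant b i.+1).1 + (continuant b i).1.
Proof. by rewrite continuantSS. Qed.

Lemma continuant_denSS b i : (continuant b i.+2).2 =
  b i.+2 * (continuant b i.+1).2 + (continuant b i).2.
Proof. by rewrite continuantSS. Qed.

Lemma continuant_det b i :
  (continuant b i.+1).1 * (continuant b i).2
  - (continuant b i).1 * (continuant b i.+1).2 = (-1) ^+ i.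
Proof.
elim: i => [|i IH]; first by rewrite /=; ring.
by rewrite continuant_numSS continuant_denSS exprS -IH; ring.
Qed.

Section PositiveTerms.
Variable b : nat -> int.
Hypothesis b_gt0 : forall i, 0 < b i.+1.

Local Notation p i := (continuant b i).1.
Local Notation q i := (continuant b i).2.

Lemma continuant_den_ge i :
  [/\ 0 < q i, q i <= q i.+1, i%:Z <= q i & i.+1%:Z <= q i.+1].
Proof.
elim: i => [|i [q0 qS qi qiS]]; first by have := b_gt0 0; rewrite /=; split; lia.
have := b_gt0 i.+1; rewrite continuant_denSS => b0.
have : q i.+1 <= b i.+2 * q i.+1 by rewrite ler_peMl; lia.
by split; lia.
Qed.

Lemma continuant_den_gt0 i : 0 < q i.
Proof. by have [] := continuant_den_ge i. Qed.

Lemma continuant_den_ge_id i : i%:Z <= q i.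
Proof. by have [] := continuant_den_ge i. Qed.

(** For positive [i] the remainder q (i + 1) - b (i + 1) q i equals q (i - 1), which lies between 0
    and q i. *)
Lemma continuant_den_bounds i :
  b i.+1 * q i <= q i.+1 /\ q i.+1 <= (b i.+1 + 1) * q i.
Proof.
case: i => [|i]; first by rewrite /=; lia.
have [q0 qS _ _] := continuant_den_ge i.
rewrite continuant_denSS; lia.
Qed.

Lemma continuant_coprime i : coprime `|p i| `|q i|.
Proof.
rewrite -coprimezE; apply/coprimezP.
have Bezout : (-1) ^+ i * - q i.+1 * p i + (-1) ^+ i * p i.+1 * q i = 1.
  transitivity ((-1) ^+ i * (p i.+1 * q i - p i * q i.+1)); first by ring.
  by rewrite continuant_det -expr2 sqrr_sign.
by exists ((-1) ^+ i * - q i.+1, (-1) ^+ i * p i.+1).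
Qed.

(** As a function of [k] this quantity starts with the values 0 and 1 and obeys the recurrence of
    the continuants, whose coefficients are positive. Hence even convergents lie below, and odd ones
    above, all later convergents. *)
Lemma continuant_cross_ge0 i k :
  0 <= (-1) ^+ i * (p (i + k) * q i - p i * q (i + k)).
Proof.
suff [] : 0 <= (-1) ^+ i * (p (i + k) * q i - p i * q (i + k)) /\
  0 <= (-1) ^+ i * (p (i + k.+1) * q i - p i * q (i + k.+1)) by [].
elim: k => [|k [IH0 IH1]].
  rewrite addn0 addn1 subrr mulr0; split => //.
  by rewrite continuant_det -expr2 sqrr_sign.
split=> //; have := b_gt0 (i + k.+1).
rewrite !addnS in IH1 *; rewrite continuant_numSS continuant_denSS => b0.
have := addr_ge0 (mulr_ge0 (ltW b0) IH1) IH0.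
by congr (0 <= _); ring.
Qed.

End PositiveTerms.

Lemma finite_cfE b i : (forall i, 0 < b i.+1) ->
  finite_cf b i = (continuant b i).1%:~R / (continuant b i).2%:~R.
Proof.
elim: i b => [|i IH] b b_gt0; first by rewrite /= divr1.
rewrite /= IH // invf_div rmorphD rmorphM /=.
have : ((continuant (fun k => b k.+1) i).1)%:~R != 0 :> rat.
  by rewrite intr_eq0; have := continuant_den_gt0 b_gt0 i.+1; rewrite /=; lia.
by move=> h; field.
Qed.

Lemma convergentE b i : (forall i, 0 < b i.+1) ->
  convergent b i = continuant b i.
Proof.
move=> b_gt0; rewrite /convergent finite_cfE // [RHS]surjective_pairing.
have q0 := continuant_den_gt0 b_gt0 i.
rewrite coprimeq_num ?coprimeq_den ?continuant_coprime //.
by rewrite gtr0_sg // mul1r gt_eqF // gtr0_norm.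
Qed.

(** * Approximation by convergents *)

Section Approximation.
Variables (R : realType) (theta : R) (b : nat -> int).
Hypothesis theta_cf : simple_cf theta b.

Local Notation p i := (continuant b i).1.
Local Notation q i := (continuant b i).2.

Let b_gt0 i : 0 < b i.+1. Proof. by have [] := theta_cf. Qed.

(** The sign turns q i theta - p i into its absolute value and keeps the recurrences below
    linear. *)
Definition cf_error i : R := (-1) ^+ i * ((q i)%:~R * theta - (p i)%:~R).

Local Notation s i := (cf_error i).

(** Replacing [theta] by the convergent of index j >= i gives a nonnegative quantity by
    [continuant_cross_ge0]; then j tends to infinity. *)
Lemma cf_error_ge0 i : 0 <= s i.
Proof.
have cvg_s : (fun j => (-1) ^+ i * ((q i)%:~R * ratr (finite_cf b j) - (p i)%:~R))
    @ \oo --> s i.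
  apply: cvgMr; apply: cvgB; last exact: cvg_cst.
  by apply: cvgMr; have [] := theta_cf.
rewrite -(cvg_lim _ cvg_s) //; apply: limr_ge.
  by apply/cvg_ex; exists (s i).
exists i => // j /= le_ij; rewrite finite_cfE // fmorph_div /= !ratr_int.
have qj0 : 0 < (q j)%:~R :> R by rewrite ltr0z continuant_den_gt0.
have -> : (-1) ^+ i * ((q i)%:~R * ((p j)%:~R / (q j)%:~R) - (p i)%:~R)
  = ((-1) ^+ i * (p j * q i - p i * q j))%:~R / (q j)%:~R :> R.
  rewrite rmorphM rmorphB !rmorphM /= rmorphXn rmorphN1; field; lra.
rewrite divr_ge0 ?(ltW qj0) // ler0z.
by rewrite -(subnKC le_ij) continuant_cross_ge0.
Qed.

Lemma cf_error_norm i : `|(q i)%:~R * theta - (p i)%:~R| = s i.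
Proof.
rewrite -(ger0_norm (cf_error_ge0 i)) /cf_error normrM.
by rewrite -signr_odd normr_sign mul1r.
Qed.

Lemma cf_error_rec i : s i = (b i.+2)%:~R * s i.+1 + s i.+2.
Proof.
rewrite /cf_error continuant_numSS continuant_denSS !rmorphD !rmorphM /=.
by rewrite !exprS; ring.
Qed.

(** The terms in [theta] cancel and leave the determinant of two consecutive convergents. *)
Lemma cf_error_det i : (q i.+1)%:~R * s i + (q i)%:~R * s i.+1 = 1.
Proof.
transitivity ((-1) ^+ i * ((p i.+1 * q i - p i * q i.+1)%:~R) : R).
  by rewrite /cf_error rmorphB !rmorphM /= exprS; ring.
by rewrite continuant_det rmorphXn rmorphN1 -expr2 sqrr_sign.
Qed.

Lemma cf_error_decr i : s i.+1 <= s i.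
Proof.
rewrite [leRHS]cf_error_rec -[leLHS]addr0 lerD ?cf_error_ge0 //.
by rewrite ler_peMl ?cf_error_ge0 // ler1z -gtz0_ge1 b_gt0.
Qed.

Lemma cf_error_antitone i j : (i <= j)%N -> s j <= s i.
Proof.
by move=> le_ij; rewrite -(subnKC le_ij); elim: (_ - _)%N => [|k IH];
  rewrite ?addn0 // addnS (le_trans (cf_error_decr _)).
Qed.

Let q_gt0 i : 0 < (q i)%:~R :> R.
Proof. by rewrite ltr0z continuant_den_gt0. Qed.

Lemma cf_error_le i : (b i.+1)%:~R * ((q i)%:~R * s i) <= 1.
Proof.
rewrite -[leRHS](cf_error_det i) mulrA -intrM.
apply: ler_wpDr; first by rewrite mulr_ge0 ?cf_error_ge0 ?(ltW (q_gt0 _)).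
rewrite ler_wpM2r ?cf_error_ge0 // ler_int.
by have [] := continuant_den_bounds b_gt0 i.
Qed.

(** In [cf_error_det], q (i + 1) is at most (b (i + 1) + 1) q i, and s (i + 1) is at most s i. *)
Lemma cf_error_ge i : 1 <= ((b i.+1)%:~R + 2) * ((q i)%:~R * s i).
Proof.
rewrite -[leLHS](cf_error_det i) mulrA.
have : (q i.+1)%:~R <= ((b i.+1)%:~R + 1) * (q i)%:~R :> R.
  rewrite -[1]/(1%:~R) -intrD -intrM ler_int.
  by have [] := continuant_den_bounds b_gt0 i.
move=> /(ler_wpM2r (cf_error_ge0 i)).
have := ler_wpM2l (ltW (q_gt0 i)) (cf_error_decr i).
by lra.
Qed.

Lemma cf_error_gt0 i : 0 < s i.
Proof.
rewrite lt_neqAle cf_error_ge0 andbT; apply/eqP => s0.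
by have := cf_error_ge i; rewrite -s0; lra.
Qed.

(* Law of best approximation: in the basis of two consecutive convergents, the
   coordinates x, y of (P, Q) satisfy x y <= 0 because |Q| < q (i + 1), whereas
   the errors of the two convergents have opposite signs. *)
Lemma cf_error_best i (P Q : int) : (P, Q) != (0, 0) -> `|Q| < q i.+1 ->
  s i <= `|Q%:~R * theta - P%:~R|.
Proof.
move=> PQ0 ltQ.
(* Cramer's rule: the determinant is a sign, so the coordinates are integers. *)
set x := (-1) ^+ i * (p i.+1 * Q - q i.+1 * P).
set y := (-1) ^+ i * (q i * P - p i * Q).
have ee : (-1) ^+ i * (p i.+1 * q i - p i * q i.+1) = 1.
  by rewrite continuant_det -expr2 sqrr_sign.
have PE : P = x * p i + y * p i.+1.
  by rewrite -[LHS]mulr1 -ee /x /y; ring.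
have QE : Q = x * q i + y * q i.+1.
  by rewrite -[LHS]mulr1 -ee /x /y; ring.
have -> : `|Q%:~R * theta - P%:~R| = `|x%:~R * s i - y%:~R * s i.+1|.
  transitivity `|(-1) ^+ i * (Q%:~R * theta - P%:~R)|.
    by rewrite normrM -signr_odd normr_sign mul1r.
  congr `|_|; rewrite PE QE !intrD !intrM /cf_error exprS.
  by ring.
clearbody x y; clear ee.
have qi := continuant_den_gt0 b_gt0 i.
have qi1 := continuant_den_gt0 b_gt0 i.+1.
have s0 := cf_error_ge0 i; have s1 := cf_error_ge0 i.+1.
have [x0|x0|x0] := ltrgtP x 0.
- have [y0|y0] := ltP y 0.
    suff : q i.+1 <= `|Q| by rewrite leNgt ltQ.
    by rewrite QE; move: (q i) (q i.+1) qi qi1 => u v u0 v0; nia.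
  rewrite distrC; apply: le_trans (ler_norm _).
  have : 1 <= - x%:~R :> R by rewrite -mulrNz ler1z; lia.
  have : 0 <= y%:~R :> R by rewrite ler0z.
  move=> /mulr_ge0 /(_ s1) h /(ler_wpM2r s0); lra.
- have [y0|y0] := ltP 0 y.
    suff : q i.+1 <= `|Q| by rewrite leNgt ltQ.
    by rewrite QE; move: (q i) (q i.+1) qi qi1 => u v u0 v0; nia.
  apply: le_trans (ler_norm _).
  have : 1 <= x%:~R :> R by rewrite ler1z; lia.
  have : 0 <= - y%:~R :> R by rewrite -mulrNz ler0z; lia.
  move=> /mulr_ge0 /(_ s1) h /(ler_wpM2r s0); lra.
(* If x = 0 then y is nonzero and |Q| >= q (i + 1), which is excluded; so |x| >= 1, as the bound by
   [s i] requires. *)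
- have [y0|y0] := eqVneq y 0.
    by move: PQ0; rewrite PE QE x0 y0 !mul0r addr0 eqxx.
  by move: ltQ; rewrite QE x0; nia.
Qed.

(* With q i <= |Q| < q (i + 1), the determinant of (P, Q) and (p i, q i) is at
   most 2 |Q| |Q theta - P| < 1 in absolute value, so it vanishes. *)
Lemma cf_error_legendre (P Q : int) : Q != 0 ->
  `|Q%:~R| * `|Q%:~R * theta - P%:~R| < 1 / 2 ->
  exists i d, P = d * p i /\ Q = d * q i.
Proof.
move=> Q0 small.
have [] := @ex_minnP (fun i => `|Q| < q i.+1).
  exists `|Q|%N; have := continuant_den_ge_id b_gt0 `|Q|.+1; lia.
move=> i ltQ min_i.
(* For i = 0 this is 1 <= |Q|, from [Q0]; otherwise it is the minimality of [i]. *)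
have leQ : q i <= `|Q|.
  case: i min_i {ltQ} => [|i] min_i; first by rewrite /=; lia.
  by rewrite leNgt; apply/negP => /min_i; rewrite ltnn.
have best := @cf_error_best i P Q.
have det0 : P * q i - Q * p i = 0.
  suff : `|P * q i - Q * p i| < 1 by lia.
  rewrite -(ltr_int R) intr_norm.
  have -> : (P * q i - Q * p i)%:~R = - ((q i)%:~R * (Q%:~R * theta - P%:~R))
     + Q%:~R * ((q i)%:~R * theta - (p i)%:~R) :> R.
    by rewrite rmorphB !rmorphM /=; ring.
  apply: le_lt_trans (ler_normD _ _) _; rewrite normrN !normrM.
  rewrite cf_error_norm.
  have {}best : s i <= `|Q%:~R * theta - P%:~R|.
    by apply: best => //; rewrite xpair_eqE negb_and Q0 orbT.
  have := ler_wpM2l (normr_ge0 (Q%:~R : R)) best.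
  have : `|(q i)%:~R| <= `|Q%:~R| :> R.
    by rewrite -!intr_norm ler_int; have := continuant_den_gt0 b_gt0 i; lia.
  move=> /(ler_wpM2r (normr_ge0 (Q%:~R * theta - P%:~R))).
  move: small; lra.
have : (q i %| Q)%Z.
  rewrite -(@Gauss_dvdzl (q i) Q (p i)).
    by apply/dvdzP; exists P; lia.
  by rewrite coprimezE coprime_sym continuant_coprime.
move=> /dvdzP[d dE]; exists i, d; split=> //.
have q0 : q i != 0 by rewrite gt_eqF ?continuant_den_gt0.
by apply: (mulIf q0); move/subr0_eq: det0 ->; rewrite dE; ring.
Qed.

End Approximation.

(** * The inhomogeneous approximation constant *)

(** The lower limit unfolds to minus the infimum, over the sets V of the filter, of the supremum of
    -f on V. As f >= 0 this infimum is at most 0, and it is at least 0 exactly when f takes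
    arbitrarily small values on each V. *)
Lemma limf_einf_abs_infty_eq0 (R : realType) (f : int -> R) :
  (forall q, 0 <= f q) ->
  limf_einf ((fun q => (f q)%:E) : discrete_topology int -> \bar R) abs_infty = 0%E
  <-> forall (e : R) (N : nat), 0 < e -> exists2 q : int, (N <= `|q|)%N & f q < e.
Proof.
move=> f_ge0; rewrite /limf_einf /limf_esup; set S := [set _ | _ in _].
have -> : (- ereal_inf S = 0 <-> ereal_inf S = 0)%E.
  by split=> [/eqP|->]; rewrite ?oppe0 // eqe_oppLR oppe0 => /eqP.
split=> [inf0 e N e0|small].
  set V := [set q : int | (N <= `|q|)%N].
  have SV : S (ereal_sup [set (- (f q)%:E)%E | q in V]).
    by exists V => //; exists N.
  have := ereal_inf_lbound SV; rewrite inf0 => sup_ge0.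
  have /ereal_sup_gt[_ [q Vq <-]] : ((- e)%:E < ereal_sup [set (- (f q)%:E)%E | q in V])%E.
    by apply: lt_le_trans sup_ge0; rewrite lte_fin oppr_lt0.
  by rewrite -EFinN lte_fin ltrN2; exists q.
apply/eqP; rewrite eq_le; apply/andP; split.
  apply: (@le_trans _ _ (ereal_sup [set (- (f q)%:E)%E | q in setT])).
    by apply: ereal_inf_lbound; exists setT => //; exists 0%N.
  by apply: ge_ereal_sup => _ [q _ <-]; rewrite -EFinN lee_fin oppr_le0.
apply: le_ereal_inf_tmp => _ [V [N _ NV] <-].
apply/lee_addgt0Pr => e e0; have [q qN fq] := small e N e0.
rewrite -leeBlDr //; apply: (@le_trans _ _ (- (f q)%:E)%E).
  by rewrite sub0e -!EFinN lee_fin lerN2 ltW.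
by apply: ereal_sup_ubound; exists q => //; exact: NV.
Qed.

Lemma dist_int_ge0 (R : realType) (x : R) : 0 <= dist_int x.
Proof.
apply: lb_le_inf; first by exists `|x - 0%:~R|; exists 0.
by move=> _ [z _ <-].
Qed.

Lemma dist_int_ltP (R : realType) (x e : R) :
  dist_int x < e <-> exists z : int, `|x - z%:~R| < e.
Proof.
split=> [/inf_lt[]|[z]].
- by exists `|x - 0%:~R|; exists 0.
- by move=> _ [z _ <-]; exists z.
- apply: le_lt_trans; apply: ge_inf; last by exists z.
  by exists 0 => _ [k _ <-].
Qed.

Lemma inhom_const_eq0 (R : realType) (theta phi : R) :
  inhom_const theta phi = 0%E <->
  forall (e : R) (N : nat), 0 < e -> exists q z : int, (N <= `|q|)%N /\
    `|q%:~R| * `|q%:~R * theta - phi - z%:~R| < e.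
Proof.
rewrite /inhom_const limf_einf_abs_infty_eq0; last first.
  by move=> q; rewrite mulr_ge0 ?dist_int_ge0.
(* Asking for [N.+1] makes q nonzero, so that |q| can be divided out. *)
have nz (q : int) N : (N.+1 <= `|q|)%N -> 0 < `|q%:~R| :> R.
  by move=> h; rewrite normr_gt0 intr_eq0; lia.
split=> small e N e0.
  have [q qN] := small e N.+1 e0; rewrite -ltr_pdivlMl ?(nz _ _ qN) //.
  move=> /dist_int_ltP[z qz]; exists q, z; split; first by lia.
  by rewrite -ltr_pdivlMl ?(nz _ _ qN).
have [q [z [qN qz]]] := small e N.+1 e0; exists q; first by lia.
rewrite -ltr_pdivlMl ?(nz _ _ qN) //; apply/dist_int_ltP; exists z.
by rewrite ltr_pdivlMl ?(nz _ _ qN).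
Qed.

(** * Leapers *)

Lemma leapS l j : leap l j.+1 = (leap l j + l j.+2).+1.
Proof. by rewrite /leap big_nat_recr //=; lia. Qed.

Lemma leap_ge l j : (j <= leap l j)%N.
Proof. by rewrite /leap leq_addl. Qed.

Lemma leap_mono l : {homo leap l : i j / (i <= j)%N}.
Proof.
move=> i j /subnKC <-; elim: (j - i)%N => [|k IH]; first by rewrite addn0.
by rewrite addnS leapS; lia.
Qed.

Lemma interleaving_cases b c a l i : interleaving b c a l ->
  (exists j, i = leap l j) \/ (exists t, b i.+1 = c t).
Proof.
case=> _ block _.
have small j : (i <= leap l j)%N ->
    (exists j, i = leap l j) \/ (exists t, b i.+1 = c t).
  elim: j => [|j IH] le_i.
    have [->|ne] := eqVneq i (leap l 0); first by left; exists 0%N.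
    right; exists i.+1; have := block 0%N i.+1; rewrite big_geq // !add0n.
    by apply; move: le_i ne; rewrite /leap big_nat1; lia.
  have [/IH//|lt_i] := leqP i (leap l j).
  have [->|ne] := eqVneq i (leap l j.+1); first by left; exists j.+1.
  right; exists (\sum_(1 <= k < j.+2) l k + (i - leap l j))%N.
  (* [i - leap l j] is the rank of [b i.+1] in its block, between 1 and [l j.+2]. *)
  rewrite -block; last by move: le_i ne; rewrite leapS; lia.
  by congr b; move: lt_i; rewrite /leap; lia.
exact/small/leap_ge.
Qed.

Lemma infinite_setNP (A : set nat) :
  (forall N, exists2 j, A j & (N <= j)%N) <-> infinite_set A.
Proof.
split=> [unbounded /finite_seqP[s As]|infA N].
  have [j Aj] := unbounded (\max_(i <- s) i).+1.
  rewrite ltnNge => /negP; apply.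
  by apply: (@leq_bigmax_seq _ s xpredT id) => //; rewrite As in Aj.
apply: contrapT => no; apply: infA.
apply: (@sub_finite_set _ _ `I_N); last exact: finite_II.
by move=> j Aj /=; rewrite ltnNge; apply/negP => Nj; apply: no; exists j.
Qed.

(** * Multipliers modulo n and pairs congruent to (m, -r) *)

Lemma invertible_modP (n g : int) : invertible_mod n g <-> coprimez g n.
Proof.
split=> [[h /eqP]|/coprimezP[[u v] /= uv]].
  rewrite eqz_mod_dvd => /dvdzP[k gh]; apply/coprimezP.
  by exists (h, - k) => /=; lia.
exists u; apply/eqP; rewrite eqz_mod_dvd; apply/dvdzP.
by exists (- v); lia.
Qed.

Lemma inhom_scaling (R : realType) (theta : R) (r m n q z : int) : n != 0 ->
  n%:~R * (q%:~R * theta - (r%:~R * theta + m%:~R) / n%:~R - z%:~R)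
  = (n * q - r)%:~R * theta - (n * z + m)%:~R.
Proof.
move=> n0; have n0R : n%:~R != 0 :> R by rewrite intr_eq0.
by rewrite intrB intrD !intrM; field.
Qed.

(** With g0 the residue of g, put n k = g0 q + r and n z = g0 p - m. Then k <= 2 q and the error at
    (k, z) is g0 / n times that of the leaper, so 2 comes from [cf_error_le]. The bound on [j] makes
    |k| grow with [j]. *)
Lemma leaper_approx_small (R : realType) (theta : R)
    (b c a : nat -> int) (l : nat -> nat)
    (htheta : simple_cf theta b) (hsplit : interleaving b c a l)
    (r m n : int) (hn : 2 <= n) (hr : 0 <= r < n) (j : nat) (g : int) :
  invertible_mod n g ->
  eqmod_pair n (g * (leaper b l j).1, g * (leaper b l j).2) (m, - r) ->
  exists q z : int, j%:Z <= n * `|q| /\ (a j)%:~R * (`|q%:~R| *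
    `|q%:~R * theta - (r%:~R * theta + m%:~R) / n%:~R - z%:~R|) <= 2.
Proof.
move=> g_inv; have [b_gt0 _] := htheta; have [_ _ <-] := hsplit.
rewrite /eqmod_pair /leaper convergentE //.
set I := leap l j; set p := (continuant b I).1; set q := (continuant b I).2.
case=> /=; rewrite -modzMml -[in X in _ -> X -> _]modzMml.
(* The residue is less than n, so g0 / n < 1; it is nonzero because g is invertible and n >= 2. *)
set g0 := (g %% n)%Z => /eqP gp /eqP gq.
have g0_gt0 : 0 < g0.
  rewrite lt_neqAle modz_ge0 ?andbT; last lia.
  apply/eqP => g00; have := g_inv; rewrite invertible_modP /coprimez => /eqP.
  by rewrite gcdzC -gcdz_modr -/g0 -g00 gcdz0; lia.
have g0_lt : g0 < n by rewrite ltz_pmod; lia.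
move: gp gq; rewrite !eqz_mod_dvd => /dvdzP[z zE] /dvdzP[k kE].
have q0 : 0 < q by exact: continuant_den_gt0.
have qj : j%:Z <= q.
  by apply: le_trans (continuant_den_ge_id b_gt0 I); rewrite lez_nat leap_ge.
have qg : q <= g0 * q by rewrite ler_peMl; lia.
have gq : g0 * q <= n * q by rewrite ler_wpM2r; lia.
have n0 : (0 : R) < n%:~R by rewrite ltr0z; lia.
have n0' : n != 0 by lia.
have nk : n * k = g0 * q + r by lia.
have k0 : 0 < k by rewrite -(pmulr_rgt0 k (_ : 0 < n)); lia.
exists k, z; split; first by rewrite gtr0_norm //; lia.
have k2q : k <= 2 * q.
  have n_gt0 : 0 < n by lia.
  rewrite -(ler_pM2l n_gt0) nk; have : n * 1 <= n * q by rewrite ler_wpM2l; lia.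
  lia.
have sE : n%:~R * `|k%:~R * theta - (r%:~R * theta + m%:~R) / n%:~R - z%:~R|
    = g0%:~R * cf_error theta b I.
  rewrite -[X in X * _](gtr0_norm n0) -normrM inhom_scaling //.
  have -> : n * k - r = g0 * q by lia.
  have -> : n * z + m = g0 * p by lia.
  rewrite !intrM -!mulrA -mulrBr normrM cf_error_norm //.
  by rewrite gtr0_norm // ltr0z.
set w := `|_ - _| in sE *.
have s0 := cf_error_ge0 htheta I.
have w_le : w <= cf_error theta b I.
  rewrite -(ler_pM2l n0) sE ler_wpM2r // ler_int; exact: ltW.
have := cf_error_le htheta I; rewrite -/q => sle.
have b0 : 0 <= (b I.+1)%:~R :> R by rewrite ler0z ltW.
apply: (@le_trans _ _ ((b I.+1)%:~R * (2 * q%:~R * cf_error theta b I))).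
  rewrite ler_wpM2l // ler_pM //; first by rewrite /w.
  rewrite -intr_norm gtr0_norm // -[2]/(2%:~R) -intrM ler_int //.
lra.
Qed.

(** The threshold 1 / (M + 2) is at most 1 / 2, as Legendre's criterion requires, and by
    [cf_error_ge] it forces b (i + 1) > M, so this term is not one of the c. The last conclusion
    serves to make [j] large when |Q| is large. *)
Lemma small_approx_leaper (R : realType) (theta : R)
    (b c a : nat -> int) (l : nat -> nat) (M : int)
    (htheta : simple_cf theta b) (hsplit : interleaving b c a l)
    (hc : forall i, `|c i| <= M)
    (r m n : int) (hn : 2 <= n) (hgcd : gcdz (gcdz r m) n = 1) (q z : int) :
  let Q := n * q - r in let P := n * z + m in
  Q != 0 -> `|Q%:~R| * `|Q%:~R * theta - P%:~R| < (M%:~R + 2)^-1 ->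
  exists j g, [/\ invertible_mod n g,
    eqmod_pair n (g * (leaper b l j).1, g * (leaper b l j).2) (m, - r) &
    `|Q%:~R| * cf_error theta b (leap l j) < 1].
Proof.
move=> Q P Q0 small; have [b_gt0 _] := htheta.
have M0 : 0 <= M by apply: le_trans (hc 0%N).
have M0R : 0 <= M%:~R :> R by rewrite ler0z.
have M2 : 0 < M%:~R + 2 :> R by lra.
have M2V : (M%:~R + 2)^-1 <= 1 / 2 :> R.
  by rewrite div1r lef_pV2 ?posrE //; lra.
have [i [d [PE QE]]] := cf_error_legendre htheta Q0 (lt_le_trans small M2V).
have d1 : 1 <= `|d%:~R| :> R.
  by rewrite -intr_norm ler1z; move: Q0; rewrite QE; case: (eqVneq d 0) => [->|]; lia.
have s0 := cf_error_ge0 htheta i.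
have errE : `|Q%:~R * theta - P%:~R| = `|d%:~R| * cf_error theta b i.
  by rewrite PE QE !intrM -!mulrA -mulrBr normrM cf_error_norm.
have Qs : `|Q%:~R| * cf_error theta b i < (M%:~R + 2)^-1.
  apply: le_lt_trans small; rewrite errE ler_wpM2l // ler_peMl //.
have qQ : (continuant b i).2%:~R <= `|Q%:~R| :> R.
  have qi0 : 0 <= (continuant b i).2%:~R :> R.
    by rewrite ler0z ltW // continuant_den_gt0.
  by rewrite QE intrM normrM (ger0_norm qi0) ler_peMl.
have bM : M < b i.+1.
  rewrite -(ltr_int R) -(ltrD2r 2) -[ltLHS]invrK -div1r ltr_pdivrMr ?invr_gt0 //.
  apply: le_lt_trans (cf_error_ge htheta i) _.
  rewrite ltr_pM2l; last by rewrite ltr_wpDl // ler0z ltW.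
  by apply: le_lt_trans Qs; rewrite ler_wpM2r.
have [[j ij]|[t bt]] := interleaving_cases i hsplit; last first.
  by have := le_lt_trans (hc t) bM; rewrite -bt ltNge ler_norm.
exists j, d; split; last by rewrite -ij; lra.
  (* A common divisor of d and n divides Q and P, hence r and m. *)
  rewrite invertible_modP /coprimez.
  have dn : (gcdz d n %| n)%Z by rewrite dvdz_gcdr.
  have dd : (gcdz d n %| d)%Z by rewrite dvdz_gcdl.
  have dr : (gcdz d n %| r)%Z.
    have -> : r = n * q - d * (continuant b i).2 by rewrite -QE /Q opprB addrC subrK.
    by rewrite rpredB // dvdz_mulr.
  have dm : (gcdz d n %| m)%Z.
    have -> : m = d * (continuant b i).1 - n * z by rewrite -PE /P addrAC subrr add0r.
    by rewrite rpredB // dvdz_mulr.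
  have : (gcdz d n %| gcdz (gcdz r m) n)%Z by rewrite !dvdz_gcd dr dm dn.
  by rewrite hgcd dvdz1 /gcdz => /eqP /= ->.
rewrite /eqmod_pair /leaper convergentE // -ij -PE -QE /=.
split; apply/eqP; rewrite eqz_mod_dvd; apply/dvdzP.
  by exists z; rewrite /P addrK mulrC.
by exists q; rewrite /Q opprK subrK mulrC.
Qed.

Theorem theorem2p3 (R : realType) (theta : R)
    (b c a : nat -> int) (l : nat -> nat)
    (htheta : simple_cf theta b)
    (hsplit : interleaving b c a l)
    (ha : (fun j => (a j)%:~R : R) @ \oo --> +oo)
    (hc : exists M : int, forall i, `|c i| <= M)
    (r m n : int) (hn : 2 <= n) (hgcd : gcdz (gcdz r m) n = 1)
    (hr : 0 <= r < n) (hm : 0 <= m < n) :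
  inhom_const theta ((r%:~R * theta + m%:~R) / n%:~R) = 0%E
  <->
  infinite_set [set j : nat | exists2 g : int, invertible_mod n g &
    eqmod_pair n (g * (leaper b l j).1, g * (leaper b l j).2) (m, - r)].
Proof.
rewrite inhom_const_eq0 -infinite_setNP.
have n0 : 0 < n%:~R :> R by rewrite ltr0z; lia.
split=> [small N|inf e N e0].
  have [M hM] := hc.
  have M0R : 0 <= M%:~R :> R by rewrite ler0z; apply: le_trans (hM 0%N).
  (* Leapers of index below [N] have error at least [delta]; with |Q| >= 1 / delta they violate the
     last conclusion of [small_approx_leaper]. *)
  set delta := cf_error theta b (leap l N).
  have delta0 : 0 < delta by exact: cf_error_gt0.
  (* The divisor 2 n n pays for |Q| <= 2 n |q| and for the factor n in [inhom_scaling]. *)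
  have e0 : 0 < (M%:~R + 2)^-1 / (2 * n%:~R * n%:~R) :> R.
    by rewrite divr_gt0 ?invr_gt0 ?mulr_gt0 //; lra.
  have [q [z [qN qz]]] := small _ (Num.bound delta^-1).+2 e0.
  set Q := n * q - r.
  have nqE : `|n * q| = n * `|q| by rewrite normrM gtr0_norm; lia.
  (* Since 0 <= r < n and n >= 2, |Q| >= n (|q| - 1) + 1 >= |q|. *)
  have q_le : `|q| <= `|Q|.
    have : 2 * (`|q| - 1) <= n * (`|q| - 1) by rewrite ler_wpM2r; lia.
    by rewrite /Q; lia.
  have Q_le : `|Q| <= 2 * n * `|q|.
    have : n * 1 <= n * `|q| by rewrite ler_wpM2l; lia.
    by rewrite /Q; lia.
  have Q0 : Q != 0 by lia.
  have [|j [g [g_inv gj Qs]]] :=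
      small_approx_leaper (z := z) htheta hsplit hM hn hgcd Q0.
    rewrite -inhom_scaling; last lia.
    rewrite normrM (gtr0_norm n0).
    set w := `|_ - _| in qz *.
    move: qz; rewrite ltr_pdivlMr ?mulr_gt0 //.
    apply: le_lt_trans.
    have : `|Q%:~R| <= 2 * n%:~R * `|q%:~R| :> R.
      by rewrite -!intr_norm -[2]/(2%:~R) -!intrM ler_int.
    have : 0 <= n%:~R * w by rewrite mulr_ge0 ?(ltW n0) /w.
    by move=> w0 /(ler_wpM2r w0); lra.
  exists j; first by exists g.
  rewrite leqNgt; apply/negP => jN.
  have := cf_error_antitone htheta (leap_mono l (ltnW jN)); rewrite -/delta => ds.
  have : `|Q%:~R| * delta < 1.
    by apply: le_lt_trans Qs; rewrite ler_wpM2l.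
  rewrite -ltr_pdivlMr // mul1r ltNge => /negP; apply.
  have dV0 : 0 <= delta^-1 by rewrite invr_ge0 ltW.
  apply: (le_trans (ltW (archi_boundP dV0))).
  by rewrite pmulrn -intr_norm ler_int; lia.
(* The summand 1 makes e a_j > 2 strict; below, j >= |n| N yields |q| >= N. *)
have [J _ aJ] := (cvgryPge _).1 ha (2 / e + 1).
have [j [g g_inv gj] jN] := inf (maxn J (`|n| * N)%N).
have [q [z [jq qz]]] := leaper_approx_small htheta hsplit hn hr g_inv gj.
exists q, z; split.
  have : n * N%:Z <= n * `|q| by lia.
  by rewrite ler_pM2l; lia.
have {aJ} : 2 / e + 1 <= (a j)%:~R by apply: aJ => /=; lia.
rewrite -lerBrDr ler_pdivrMr // => ae.
have a0 : 0 < (a j)%:~R :> R.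
  by have := divr_gt0 (ltr0Sn R 1) e0; move: ae; rewrite -ler_pdivrMr //; lra.
rewrite -(ltr_pM2l a0); apply: le_lt_trans qz _; lra.
Qed.
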